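(* Let $m,n\ge1$ be integers, let $X=\{1,\dots,m\}\times\{1,\dots,n\}$, and let $\mathcal P=\{C_1,\dots,C_m\}$ with $C_i=\{i\}\times\{1,\dots,n\}$. A transformation $f=[f_1,\dots,f_m;\overline f]\in\mathcal T(X,\mathcal P)$ is an idempotent if and only if (i) $\overline f\in E(\mathcal T_m)$, (ii) $f_i\in E(\mathcal T_n)$ for all $i\in\mathrm{im}(\overline f)$, and (iii) $\mathrm{im}(f_i)\subseteq\mathrm{im}(f_{i\overline f})$ for all $i\in\{1,\dots,m\}\setminus\mathrm{im}(\overline f)$. Moreover, $$|E(\mathcal T(X,\mathcal P))|=\sum_{k=1}^m\ \sum_{\mathbf a}\binom{m}{k,a_1,\dots,a_k}\sum_{\mathbf l}\ \prod_{i=1}^k\binom n{l_i}\,l_i^{(a_i+1)n-l_i},$$ where the inner sums are over all $\mathbf l=(l_1,\dots,l_k)\in\{1,\dots,n\}^k$ and all $\mathbf a=(a_1,\dots,a_k)$ of non-negative integers with $a_1+\cdots+a_k=m-k$.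
   Context: Maps are written on the right of their arguments and composed from left to right. $\mathcal T_k$ is the monoid of all functions $\{1,\dots,k\}\to\{1,\dots,k\}$; $E(M)$ denotes the set of idempotents of a monoid $M$. $\mathcal T(X,\mathcal P)$ is the monoid of all functions $f:X\to X$ such that for every $i$ there is a $j$ with $C_if\subseteq C_j$. Each $f\in\mathcal T(X,\mathcal P)$ is uniquely written $f=[f_1,\dots,f_m;\overline f]$ with $\overline f\in\mathcal T_m$ and $f_1,\dots,f_m\in\mathcal T_n$, where $(i,j)f=(i\overline f,jf_i)$ for all $i\in\{1,\dots,m\}$, $j\in\{1,\dots,n\}$. The multinomial coefficient is $\binom{m}{k,a_1,\dots,a_k}=\frac{m!}{k!\,a_1!\cdots a_k!}$. *)

(* Defs.v *)
From mathcomp Require Import all_boot.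

Set Implicit Arguments.
Unset Strict Implicit.
Unset Printing Implicit Defensive.

(* Maps act on the right: in [tmul f g] the map f is applied first. *)
Definition tmul (T : finType) (f g : {ffun T -> T}) : {ffun T -> T} :=
  [ffun x => g (f x)].

Definition tone (T : finType) : {ffun T -> T} := [ffun x => x].

(* E(M), for M a submonoid of the full transformation monoid on T. *)
Definition E (T : finType) (M : {set {ffun T -> T}}) : {set {ffun T -> T}} :=
  [set f in M | tmul f f == f].

(* The monoid T_k; the points 1, ..., k are encoded as 0, ..., k - 1. *)
Definition Tfull (k : nat) : {set {ffun 'I_k -> 'I_k}} := [set: _].

Definition block (m n : nat) (i : 'I_m) : {set 'I_m * 'I_n} :=
  [set x | x.1 == i].

(* The monoid T(X, P), with X = 'I_m * 'I_n and P = {block i | i : 'I_m}. *)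
Definition TXP (m n : nat) : {set {ffun 'I_m * 'I_n -> 'I_m * 'I_n}} :=
  [set f : {ffun 'I_m * 'I_n -> 'I_m * 'I_n} |
    [forall i, exists j, f @: block n i \subset block n j]].

(* f = [f_1, ..., f_m; fbar]. *)
Definition decomp (m n : nat) (f : {ffun 'I_m * 'I_n -> 'I_m * 'I_n})
    (fs : {ffun 'I_m -> {ffun 'I_n -> 'I_n}}) (fbar : {ffun 'I_m -> 'I_m}) :
    Prop :=
  forall i j, f (i, j) = (fbar i, fs i j).

(* The quotient is exact when a_1 + ... + a_k = m - k and k <= m; see
   [multinom_exact]. *)
Definition multinom (m k : nat) (a : 'I_k -> nat) : nat :=
  m`! %/ (k`! * \prod_(i < k) (a i)`!).

Lemma multinom_exact (m k : nat) (a : 'I_k -> nat) :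
  k <= m -> \sum_(i < k) a i = m - k ->
  multinom m a * (k`! * \prod_(i < k) (a i)`!) = m`!.
Proof.
have dvd_fact p q : p`! * q`! %| (p + q)`!.
  by rewrite -(bin_fact (leq_addr q p)) addKn dvdn_mull.
move=> le_km sum_a; rewrite divnK // -(subnKC le_km) -sum_a.
apply: dvdn_trans (dvd_fact _ _); rewrite dvdn_pmul2l ?fact_gt0 //.
elim/big_rec2: _ => // i p q _ dvd_pq.
by apply: dvdn_trans (dvd_fact _ _); rewrite dvdn_pmul2l ?fact_gt0.
Qed.

Lemma TXP1 (m n : nat) : tone _ \in TXP m n.
Proof.
rewrite inE; apply/forallP=> i; apply/existsP; exists i.
by apply/subsetP=> _ /imsetP[x xi ->]; rewrite ffunE.
Qed.

Lemma TXPM (m n : nat) (f g : {ffun 'I_m * 'I_n -> 'I_m * 'I_n}) :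
  f \in TXP m n -> g \in TXP m n -> tmul f g \in TXP m n.
Proof.
rewrite !inE => /forallP fP /forallP gP; apply/forallP=> i.
have [j /subsetP fij] := existsP (fP i); have [l /subsetP gjl] := existsP (gP j).
apply/existsP; exists l; apply/subsetP=> _ /imsetP[x xi ->]; rewrite ffunE.
by apply/gjl/imset_f/fij/imset_f.
Qed.

Lemma decomp_exists (m n : nat) (f : {ffun 'I_m * 'I_n -> 'I_m * 'I_n}) :
  f \in TXP m n <-> exists fs fbar, decomp f fs fbar.
Proof.
rewrite inE; split=> [/forallP fP | [fs [fbar fE]]]; last first.
  apply/forallP=> i; apply/existsP; exists (fbar i).
  by apply/subsetP=> _ /imsetP[[i' j] /[!inE] /= /eqP-> ->]; rewrite fE.
exists [ffun i => [ffun j => (f (i, j)).2]].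
exists [ffun i => odflt i [pick l | f @: block n i \subset block n l]] => i j.
rewrite !ffunE; case: pickP => [l /subsetP fil | no_l] /=; last first.
  by have /existsP[l] := fP i; rewrite no_l.
have /fil : f (i, j) \in f @: block n i by apply: imset_f; rewrite inE.
by rewrite inE => /eqP <-; case: (f _).
Qed.

Lemma decomp_unique (m n : nat) (f : {ffun 'I_m * 'I_n -> 'I_m * 'I_n}) fs gs
    fbar gbar :
  0 < n -> decomp f fs fbar -> decomp f gs gbar -> fs = gs /\ fbar = gbar.
Proof.
move=> n_gt0 fE gE; have eq_fg i j := etrans (esym (fE i j)) (gE i j).
split; apply/ffunP=> i; last by have [] := eq_fg i (Ordinal n_gt0).
by apply/ffunP=> j; have [] := eq_fg i j.
Qed.

(* Main.v *)
Require Import Defs.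
From mathcomp Require Import all_boot.

(** An idempotent fbar is a retraction of the m blocks onto its image B.  For
    fixed fbar, the block maps f_i with i in B are arbitrary idempotents of
    T_n; if f_i has rank l, each of the c blocks retracted onto block i carries
    one of the l^n maps into the image of f_i.  Summing over f_i gives the
    factor sum_l binom(n, l) l^(n - l) l^(n c).  The number of retractions onto
    B with fibre sizes a_1, ..., a_k is the multinomial coefficient
    (m - k)! / (a_1! ... a_k!), and there are binom(m, k) choices of B. *)

Set Implicit Arguments.
Unset Strict Implicit.
Unset Printing Implicit Defensive.

(** * Counting words with prescribed letter multiplicities *)

(** By induction on the length: a permutation with first letter [x] continues with a permutation of
    [rem x s]. Removing [x] lowers only its own multiplicity, so the factorials lose exactly one
    factor [count_mem x s], and these multiplicities add up to [size s]. *)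
Lemma mul_size_permutations (T : finType) (s : seq T) :
  size (permutations s) * \prod_x (count_mem x s)`! = (size s)`!.
Proof.
have [n] := ubnPeq (size s); elim: n s => [|n IHn] s /eqP size_s.
  by case: s size_s => // _; rewrite big1 //= muln1.
rewrite (perm_size (permutationsE _)); last by rewrite size_s.
rewrite size_allpairs_dep.
rewrite sumnE big_map big_distrl /= factS -[in X in X * _]size_s -sum1_size.
(* The factor [size s] of the factorial is split into the multiplicities of the distinct letters, to
   be matched with the choices of a first letter. *)
rewrite -(big_undup_iterop_count _ s xpredT) /= big_distrl /=.
rewrite big_seq [in RHS]big_seq.
apply: eq_bigr => x; rewrite mem_undup => s_x.
have size_rem_s : size (rem x s) = n by rewrite size_rem // size_s.
have := IHn (rem x s); rewrite size_rem_s eqxx => /(_ isT).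
have /permP count_s := perm_to_rem s_x.
rewrite Monoid.iteropE iter_addn_0 mul1n => <-.
have count_x : count_mem x s = (count_mem x (rem x s)).+1.
  by rewrite count_s /= eqxx.
rewrite (bigD1 x) // [in RHS](bigD1 x) //= count_x factS.
rewrite mulnCA -!mulnA; congr (_ * _); rewrite mulnCA; congr (_ * (_ * _)).
apply: eq_bigr => y /negPf neq_yx.
by rewrite count_s /= eq_sym neq_yx.
Qed.

Lemma card_family_prod (I J : finType) (F : I -> pred J) :
  #|family F| = \prod_i #|F i|.
Proof. by rewrite card_family foldrE big_map big_enum. Qed.

(** * Retractions of a finite set onto a subset *)

Section Retractions.

Variable T : finType.
Implicit Types (f : {ffun T -> T}) (B : {set T}).

(** Written as a family of independent pointwise choices, so that its cardinality is a product. *)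
Definition retractions B : {set {ffun T -> T}} :=
  [set f in family (fun x => if x \in B then pred1 x else [pred y in B])].

Lemma retractionsP B f :
  reflect ((forall x, f x \in B) /\ {in B, forall x, f x = x})
          (f \in retractions B).
Proof.
rewrite inE; apply: (iffP familyP) => [fB | [fB fK] x].
  split=> x; first by have := fB x; case: ifP => // Bx /eqP->.
  by move=> Bx; have := fB x; rewrite Bx => /eqP.
by case: ifP => Bx; rewrite inE //; apply/eqP/fK.
Qed.

Lemma in_retractions B f :
  (f \in retractions B) = (tmul f f == f) && (f @: setT == B).
Proof.
apply/retractionsP/andP => [[fB fK] | [/eqP/ffunP ff /eqP <-]].
  split; first by apply/eqP/ffunP => x; rewrite ffunE fK.
  apply/eqP/setP => y; apply/imsetP/idP => [[x _ ->] // | By].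
  by exists y; rewrite ?fK.
split=> [x | _ /imsetP[x _ ->]]; first exact: imset_f.
by have := ff x; rewrite ffunE.
Qed.

(** Idempotents are sorted by rank and then by image; as [T] is nonempty, so is every image, and the
    rank starts at 1. *)
Lemma sum_idempotents (F : {ffun T -> T} -> nat) : 0 < #|T| ->
  \sum_(f | tmul f f == f) F f =
  \sum_(1 <= k < #|T|.+1) \sum_(B : {set T} | #|B| == k)
    \sum_(f in retractions B) F f.
Proof.
move=> /card_gt0P[x0 _]; rewrite big_geq_mkord.
have card_lt f : #|f @: setT| < #|T|.+1 by rewrite ltnS max_card.
rewrite (partition_big (fun f => Ordinal (card_lt f)) (fun k => 1 <= k)) /=.
  apply: eq_bigr => k _.
  rewrite (partition_big (fun f => f @: setT) (fun B => #|B| == k)) /=.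
    apply: eq_bigr => B /eqP cardB; apply: eq_bigl => f.
    rewrite in_retractions -andbA; congr (_ && _).
    by apply: andb_idl => /eqP imf; rewrite -val_eqE /= imf cardB.
  by move=> f /andP[_ /eqP <-].
by move=> f _; apply/card_gt0P; exists (f x0); apply: imset_f.
Qed.

Lemma card_retractions B : #|retractions B| = #|B| ^ (#|T| - #|B|).
Proof.
rewrite cardsE card_family_prod (bigID (mem B)) /= big1 ?mul1n => [|x ->].
  rewrite (eq_bigr (fun=> #|B|)) => [|x /negPf-> //].
  rewrite prod_nat_const -(cardsC B) addKn; congr (_ ^ _).
  by apply: eq_card => x /[!inE].
exact: card1.
Qed.

(** Only points outside [B] count: for a retraction onto [B], the whole fibre over a point of [B]
    has one point more. These sizes are the a_i of the theorem. *)
Definition fibre_size B f x := #|[set y in ~: B | f y == x]|.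

Lemma fibre_sizeE B f x : fibre_size B f x = count_mem x (map f (enum (~: B))).
Proof.
rewrite count_map -sum1_count big_enum_cond /= sum1dep_card.
by apply: eq_card => y; rewrite !inE.
Qed.

(* A retraction onto B is the word of its values on the complement of B; the
   words with prescribed letter counts are the permutations of one word. *)
Lemma mul_card_retractions_fibre B (b : T -> nat) :
    \sum_(x in B) b x = #|~: B| ->
  #|[set f in retractions B | [forall x in B, fibre_size B f x == b x]]|
    * \prod_(x in B) (b x)`! = #|~: B|`!.
Proof.
move=> sum_b; set A := [set f in _ | _]; set e := enum (~: B).
(* The reference word: [b x] copies of each letter [x] of [B]. *)
pose s := flatten [seq nseq (b x) x | x <- enum B].
have count_s y : count_mem y s = if y \in B then b y else 0.
  rewrite count_flatten -map_comp sumnE big_map big_enum /=.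
  case: ifP => By; last first.
    rewrite big1 // => x Bx; rewrite count_nseq /=; case: eqP => // eq_xy.
    by rewrite -eq_xy Bx in By.
  rewrite (bigD1 y) //= count_nseq /= eqxx mul1n big1 ?addn0 // => x.
  by case/andP=> _ /negPf neq_xy; rewrite count_nseq /= neq_xy.
have size_s : size s = #|~: B|.
  rewrite size_flatten /shape -map_comp sumnE big_map big_enum /= -sum_b.
  by apply: eq_bigr => x _; rewrite size_nseq.
have s_B x : x \in s -> x \in B.
  by rewrite -has_pred1 has_count count_s; case: ifP.
have inj_e : {in A &, injective (fun f => map f e)}.
  move=> f g /setIdP[/retractionsP[_ fK] _] /setIdP[/retractionsP[_ gK] _].
  move=> /eq_in_map eq_fg; apply/ffunP => x.
  by have [Bx | B'x] := boolP (x \in B);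
    [rewrite fK ?gK | apply: eq_fg; rewrite mem_enum inE].
have perm_A : perm_eq [seq map f e | f <- enum A] (permutations s).
  apply: uniq_perm; rewrite ?permutations_uniq //.
    rewrite map_inj_in_uniq ?enum_uniq // => f g.
    by rewrite !mem_enum; apply: inj_e.
  move=> t; rewrite mem_permutations; apply/mapP/idP => [[f]|perm_t].
    rewrite mem_enum => /setIdP[/retractionsP[fB _] /forall_inP fb] ->.
    apply/allP=> y _ /=; rewrite count_s -fibre_sizeE; case: ifP => [/fb // | B'y].
    rewrite /fibre_size cards_eq0; apply/eqP/setP => x; rewrite !inE.
    by apply/negP=> /andP[_ /eqP fx]; rewrite -fx fB in B'y.
  have size_t : size t = size e by rewrite (perm_size perm_t) size_s cardE.
  (* The retraction whose word is [t]: a point outside [B] goes to the letter at its position in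
     [e]. *)
  pose f := [ffun x => if x \in B then x else nth x t (index x e)].
  have map_f : t = map f e.
    case De: e => [|x0 e'].
      by apply/nilP; rewrite /nilp size_t De.
    rewrite -De; apply: (@eq_from_nth _ x0); first by rewrite size_map.
    move=> i lt_it; have lt_ie : i < size e by rewrite -size_t.
    rewrite (nth_map x0) // ffunE index_uniq ?enum_uniq //.
    have /negPf-> : nth x0 e i \notin B.
      by rewrite -in_setC -mem_enum mem_nth.
    exact: set_nth_default.
  exists f => //; rewrite mem_enum; apply/setIdP; split.
    apply/retractionsP; split=> [x | x Bx]; rewrite ffunE ?Bx //.
    case: ifP => // B'x; apply: s_B; rewrite -(perm_mem perm_t) mem_nth //.
    by rewrite size_t index_mem mem_enum inE B'x.
  apply/forall_inP => x Bx; rewrite fibre_sizeE -/e -map_f.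
  by rewrite (permP perm_t) count_s Bx.
rewrite cardE -(size_map (fun f : {ffun T -> T} => map f e)) (perm_size perm_A).
(* Letters outside [B] do not occur in [s] and contribute only 0! = 1. *)
rewrite -size_s -mul_size_permutations; congr (_ * _); rewrite big_mkcond /=.
by apply: eq_bigr => x _; rewrite count_s; case: ifP.
Qed.

End Retractions.


(** * Block maps over a fixed retraction of the blocks *)

(** The contribution of an image block onto which [c] other blocks are retracted: one factor of the
    theorem's product, summed over l. *)
Definition block_weight (n c : nat) : nat :=
  \sum_(1 <= l < n.+1) 'C(n, l) * l ^ ((c + 1) * n - l).

(** There are binom(n, l) l^(n - l) idempotents of rank l, and (n - l) + n c = (c + 1) n - l since l
    <= n. *)
Lemma sum_idempotents_rank (n c : nat) : 0 < n ->
  \sum_(f : {ffun 'I_n -> 'I_n} | tmul f f == f) #|codom f| ^ (n * c) =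
  block_weight n c.
Proof.
move=> n_gt0; rewrite sum_idempotents ?card_ord // /block_weight.
rewrite !big_nat; apply: eq_bigr => l /andP[_]; rewrite ltnS => le_ln.
rewrite (eq_bigr (fun=> l ^ ((c + 1) * n - l))) => [|B /eqP cardB].
  by rewrite sum_nat_const -cardsE card_draws card_ord.
rewrite (eq_bigr (fun=> l ^ (n * c))) => [|f].
  rewrite sum_nat_const card_retractions cardB card_ord -expnD.
  by rewrite mulnDl mul1n mulnC addnC addnBA.
rewrite in_retractions -cardB => /andP[_ /eqP <-]; congr (_ ^ _).
by apply: eq_card => x; apply/codomP/imsetP => -[y]; [exists y | exists y].
Qed.

Lemma card_codom_sub (S : finType) (h : {ffun S -> S}) :
  #|[pred g : {ffun S -> S} | codom g \subset codom h]| = #|codom h| ^ #|S|.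
Proof.
rewrite -card_ffun_on; apply: eq_card => g; rewrite !inE.
apply/subsetP/ffun_onP => [gh x | gh _ /codomP[x ->] //].
exact/gh/codom_f.
Qed.

(** Once the idempotents on [B] are fixed, the other components are independent, with
    [#|codom (fs (g i))| ^ n] choices at [i]. Grouping these by [g i] gives a product over [B], and
    summing over the idempotents distributes over it. *)
Lemma card_components (T : finType) (n : nat) (B : {set T})
    (g : {ffun T -> T}) : 0 < n -> g \in retractions B ->
  #|[set fs : {ffun T -> {ffun 'I_n -> 'I_n}} |
      [forall i in B, tmul (fs i) (fs i) == fs i]
      && [forall (i | i \notin B), codom (fs i) \subset codom (fs (g i))]]|
    = \prod_(i in B) block_weight n (fibre_size B g i).
Proof.
move=> n_gt0 /retractionsP[gB gK].
pose idem := [pred f : {ffun 'I_n -> 'I_n} | tmul f f == f].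
pose f0 := tone 'I_n.
under eq_bigr do rewrite -sum_idempotents_rank //.
rewrite (big_distr_big_dep f0) -sum1dep_card.
(* Restriction to [B], padded by the default [f0] that partial families take off their support. *)
pose res (fs : {ffun T -> {ffun 'I_n -> 'I_n}}) :=
  [ffun i => if i \in B then fs i else f0].
rewrite (partition_big res (mem (pfamily f0 (mem B) (fun=> idem)))) /=; last first.
  move=> fs /andP[/forall_inP fs_idem _]; apply/pfamilyP; split=> [|i Bi].
    by apply/subsetP=> i; rewrite inE ffunE; case: ifP => // _ /eqP[].
  by rewrite !ffunE Bi; apply: fs_idem.
apply: eq_bigr => e /pfamilyP[/subsetP supp_e e_idem].
pose F i := if i \in B then pred1 (e i) else
  [pred f : {ffun 'I_n -> 'I_n} | codom f \subset codom (e (g i))].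
transitivity #|family F|.
  rewrite sum1dep_card cardsE; apply: eq_card => fs; rewrite !inE.
  apply/andP/familyP => [[/andP[_ /forall_inP fs_sub] /eqP De] i | fsF].
    rewrite /F -De !ffunE gB; case: ifP => Bi; rewrite !inE ?Bi //.
    by apply: fs_sub; rewrite Bi.
  have eq_fs i : i \in B -> fs i = e i.
    by move=> Bi; have:= fsF i; rewrite /F Bi => /eqP.
  split; first (apply/andP; split; apply/forall_inP).
  - by move=> i Bi; rewrite eq_fs //; apply: e_idem.
  - by move=> i /negPf B'i; have:= fsF i; rewrite /F B'i inE (eq_fs (g i)).
  apply/eqP/ffunP=> i; rewrite ffunE; case: ifP => [/eq_fs // | B'i].
  by apply/esym/eqP; apply: contraFT B'i; apply: supp_e.
rewrite card_family_prod (bigID (mem B)) /= big1 => [|i Bi]; last first.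
  by rewrite /F Bi card1.
rewrite mul1n (partition_big g (mem B)) //=; apply: eq_bigr => j Bj.
rewrite (eq_bigr (fun=> #|codom (e j)| ^ n)) => [|i /andP[/negPf B'i /eqP gi]].
  rewrite prod_nat_const expnM; congr (_ ^ _).
  rewrite /fibre_size cardsE; apply: eq_card => i.
  by rewrite -[LHS]/((i \notin B) && (g i == j)) -in_setC.
by rewrite /F B'i card_codom_sub gi card_ord.
Qed.

(** * Sorting retractions by fibre sizes *)

Lemma sum_fibre_size (T : finType) (B : {set T}) (g : {ffun T -> T}) :
  g \in retractions B -> \sum_(x in B) fibre_size B g x = #|~: B|.
Proof.
case/retractionsP=> gB _; rewrite -sum1_card [RHS](partition_big g (mem B)) //=.
by apply: eq_bigr => x _; rewrite sum1dep_card.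
Qed.

(** With m = [#|T|] and k = [#|B|], exactly (m - k)! / (a_1! ... a_k!) retractions have fibre sizes
    [a] along the enumeration of [B]. The factor binom(m, k) turns this into the multinomial
    coefficient, whose k! thus comes from the choice of [B]. *)
Lemma bin_mul_sum_retractions (T : finType) (B : {set T}) (w : nat -> nat) :
  'C(#|T|, #|B|) *
    \sum_(g in retractions B) \prod_(x in B) w (fibre_size B g x) =
  \sum_(a : {ffun 'I_#|B| -> 'I_(#|T| - #|B|).+1}
       | \sum_(i < #|B|) a i == #|T| - #|B|)
    multinom #|T| (fun i => a i : nat) * \prod_(i < #|B|) w (a i).
Proof.
set m := #|T|; set k := #|B|.
have cardB' : #|~: B| = m - k by rewrite -[m](cardsC B) addKn.
have le_km : k <= m by apply: max_card.
have lt_fibre g x : fibre_size B g x < (m - k).+1.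
  by rewrite ltnS -cardB'; apply/subset_leq_card/subsetP=> y /setIdP[].
pose sizes g := [ffun i : 'I_k => Ordinal (lt_fibre g (enum_val i))].
rewrite (partition_big sizes (fun a => \sum_(i < k) a i == m - k)) /=.
  rewrite big_distrr /=; apply: eq_bigr => a /eqP sum_a.
  rewrite (eq_bigr (fun=> \prod_(i < k) w (a i))) => [|g /andP[_ /eqP <-]].
    rewrite sum_nat_cond_const mulnA; congr (_ * _).
    set A := [set g | _].
    (* Transports [a] from indices to points of [B]; at a point of [B] the sum has a single term. *)
    pose b x := \sum_(i < k | enum_val i == x :> T) a i.
    have b_val i : b (enum_val i) = a i.
      by rewrite /b (big_pred1 i) // => j; rewrite (inj_eq enum_val_inj).
    have sum_b : \sum_(x in B) b x = #|~: B|.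
      by rewrite cardB' -sum_a [LHS]big_enum_val; apply: eq_bigr => i _.
    have cardA : #|A| * \prod_(i < k) (a i)`! = (m - k)`!.
      rewrite -[RHS](congr1 factorial cardB').
      rewrite -(mul_card_retractions_fibre sum_b) [in RHS]big_enum_val.
      congr (_ * _); last by apply: eq_bigr => i _; rewrite b_val.
      apply: eq_card => g; rewrite !inE; congr (_ && _).
      apply/eqP/forall_inP => [sizes_g x Bx | fib_g].
        rewrite -(enum_rankK_in Bx Bx) b_val -sizes_g.
        by rewrite ffunE.
      apply/ffunP=> i; apply/val_inj/eqP; rewrite ffunE /= -b_val.
      exact/fib_g/enum_valP.
    have fact_gt0_a : 0 < k`! * \prod_(i < k) (a i)`!.
      by rewrite muln_gt0 fact_gt0 prodn_gt0 // => i; apply: fact_gt0.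
    apply/eqP; rewrite -(eqn_pmul2r fact_gt0_a) multinom_exact //.
    by rewrite -mulnA [#|A| * _]mulnCA cardA bin_fact.
  by rewrite [LHS]big_enum_val; apply: eq_bigr => i _; rewrite ffunE.
move=> g /sum_fibre_size sum_g; apply/eqP; rewrite -[RHS]cardB' -sum_g.
by rewrite [RHS]big_enum_val; apply: eq_bigr => i _; rewrite ffunE.
Qed.

(** * Idempotency in terms of the components *)

Lemma mem_E_Tfull (k : nat) (f : {ffun 'I_k -> 'I_k}) :
  (f \in E (Tfull k)) = (tmul f f == f).
Proof. by rewrite !inE. Qed.

Lemma mem_imsetT_codom (T : finType) (f : {ffun T -> T}) (x : T) :
  (x \in f @: setT) = (x \in codom f).
Proof. by apply/imsetP/codomP => -[y]; exists y. Qed.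

(** Read on pairs, idempotency says that [fbar] is idempotent and that [fs (fbar i)] fixes every
    value of [fs i]. For [i] in the image of [fbar] this is idempotency of [fs i]; for the other
    [i], as [fs (fbar i)] is idempotent, it is inclusion of images. *)
Lemma idempotent_decomp (m n : nat)
    (f : {ffun 'I_m * 'I_n -> 'I_m * 'I_n})
    (fs : {ffun 'I_m -> {ffun 'I_n -> 'I_n}}) (fbar : {ffun 'I_m -> 'I_m}) :
  0 < n -> decomp f fs fbar ->
  (tmul f f == f) =
    [&& tmul fbar fbar == fbar,
        [forall i in fbar @: setT, tmul (fs i) (fs i) == fs i]
      & [forall (i | i \notin fbar @: setT),
           codom (fs i) \subset codom (fs (fbar i))]].
Proof.
move=> n_gt0 fE.
have -> : (tmul f f == f) =
  [forall i, (fbar (fbar i) == fbar i)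
             && [forall j, fs (fbar i) (fs i j) == fs i j]].
  apply/eqP/forallP => [/ffunP ff i | ff]; last first.
    apply/ffunP=> -[i j]; have /andP[/eqP ffi /forallP/(_ j)/eqP fsj] := ff i.
    by rewrite ffunE !fE ffi fsj.
  have {}ff j : (fbar (fbar i), fs (fbar i) (fs i j)) = (fbar i, fs i j).
    by have := ff (i, j); rewrite ffunE !fE.
  (* A point of the block is needed to read off the equation for [fbar]. *)
  have [-> _] := ff (Ordinal n_gt0); rewrite eqxx.
  by apply/forallP=> j; have [_ ->] := ff j.
apply/forallP/and3P => [ff | [/eqP/ffunP fbar2 /forall_inP fs2 /forall_inP sub] i].
  have fbarK i : fbar (fbar i) = fbar i by have /andP[/eqP] := ff i.
  have fsK i j : fs (fbar i) (fs i j) = fs i j.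
    by have /andP[_ /forallP/(_ j)/eqP] := ff i.
  split.
  - by apply/eqP/ffunP=> i; rewrite ffunE.
  - apply/forall_inP=> _ /imsetP[i _ ->]; apply/eqP/ffunP=> j.
    by rewrite ffunE -{1}fbarK fsK.
  apply/forall_inP=> i _; apply/subsetP=> _ /codomP[j ->].
  by rewrite -fsK codom_f.
have im_fbar : fbar i \in fbar @: setT by apply: imset_f.
have /eqP/ffunP fsK := fs2 _ im_fbar.
rewrite -{2}[fbar i]fbar2 ffunE eqxx; apply/forallP=> j; apply/eqP.
have [/imsetP[i' _ Di] | /sub/subsetP/(_ _ (codom_f _ j))/codomP[j' ->]] :=
  boolP (i \in fbar @: setT); last by have:= fsK j'; rewrite ffunE.
have -> : fbar i = i by rewrite Di -[RHS]fbar2 ffunE.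
have /fs2/eqP/ffunP/(_ j) : i \in fbar @: setT by rewrite Di imset_f.
by rewrite ffunE.
Qed.

(** * Characterization and enumeration of the idempotents of T(X, P) *)

Theorem proposition3p1 (m n : nat) (hm : 1 <= m) (hn : 1 <= n) :
  (forall (f : {ffun 'I_m * 'I_n -> 'I_m * 'I_n})
          (fs : {ffun 'I_m -> {ffun 'I_n -> 'I_n}})
          (fbar : {ffun 'I_m -> 'I_m}),
     f \in TXP m n -> decomp f fs fbar ->
     (f \in E (TXP m n) <->
      [/\ fbar \in E (Tfull m),
          forall i : 'I_m, i \in codom fbar -> fs i \in E (Tfull n)
        & forall i : 'I_m, i \notin codom fbar ->
            codom (fs i) \subset codom (fs (fbar i))]))
  /\
  #|E (TXP m n)| =
    \sum_(1 <= k < m.+1)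
      \sum_(a : {ffun 'I_k -> 'I_(m - k).+1} | \sum_(i < k) a i == m - k)
        multinom m (fun i => a i : nat) *
        \sum_(l : {ffun 'I_k -> 'I_n.+1} | [forall i, 1 <= l i])
          \prod_(i < k) ('C(n, l i) * l i ^ ((a i + 1) * n - l i)).
Proof.
split=> [f fs fbar TXPf fE|].
  rewrite inE TXPf /= (idempotent_decomp hn fE); split.
    case/and3P=> fbar2 /forall_inP fs2 /forall_inP sub; split=> [|i|i].
    - by rewrite mem_E_Tfull.
    - by rewrite -mem_imsetT_codom mem_E_Tfull; apply: fs2.
    - by rewrite -mem_imsetT_codom; apply: sub.
  rewrite mem_E_Tfull => -[-> fs2 sub] /=; apply/andP; split.
    apply/forall_inP=> i; rewrite mem_imsetT_codom -mem_E_Tfull.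
    exact: fs2.
  by apply/forall_inP=> i; rewrite mem_imsetT_codom; apply: sub.
(* The inverse of the decomposition; being injective, it reduces the count to pairs ([fbar],
   [fs]). *)
pose glue (p : {ffun 'I_m -> 'I_m} * {ffun 'I_m -> {ffun 'I_n -> 'I_n}}) :=
  [ffun x : 'I_m * 'I_n => (p.1 x.1, p.2 x.1 x.2)].
have decomp_glue p : decomp (glue p) p.2 p.1 by move=> i j; rewrite ffunE.
have glue_inj : injective glue.
  move=> [g fs] [g' fs'] eq_glue.
  have := decomp_glue (g', fs'); rewrite -eq_glue => /decomp_unique.
  by case/(_ _ _ hn (decomp_glue (g, fs))) => /= -> ->.
pose good (g : {ffun 'I_m -> 'I_m}) (fs : {ffun 'I_m -> {ffun 'I_n -> 'I_n}}) :=
  [forall i in g @: setT, tmul (fs i) (fs i) == fs i]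
  && [forall (i | i \notin g @: setT), codom (fs i) \subset codom (fs (g i))].
have -> : E (TXP m n) =
    glue @: [set p | (tmul p.1 p.1 == p.1) && good p.1 p.2].
  apply/setP=> f; apply/setIdP/imsetP => [[TXPf ff] | [p]].
    have [fs [g fE]] := (decomp_exists f).1 TXPf.
    exists (g, fs); first by rewrite inE -(idempotent_decomp hn fE).
    by apply/ffunP=> -[i j]; rewrite ffunE fE.
  rewrite inE -(idempotent_decomp hn (decomp_glue p)) => pp ->; split=> //.
  by apply/decomp_exists; exists p.2, p.1.
rewrite card_imset // -sum1dep_card.
rewrite -(pair_big_dep (fun g => tmul g g == g) good (fun _ _ => 1)) /=.
rewrite sum_idempotents ?card_ord // !big_nat; apply: eq_bigr => k k_range.
pose w := block_weight n.
pose rhs k := \sum_(a : {ffun 'I_k -> 'I_(m - k).+1} | \sum_(i < k) a i == m - k)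
  multinom m (fun i => a i : nat) * \prod_(i < k) w (a i).
transitivity (rhs k); last first.
  apply: eq_bigr => a _; congr (_ * _); rewrite /w /block_weight.
  rewrite (eq_bigr _ (fun i _ => big_geq_mkord 1 n.+1 xpredT _)).
  (* The product of the sums over l_i expands into one sum over all tuples [l]. *)
  rewrite bigA_distr_big_dep; apply: eq_bigl => l.
  by apply/familyP/forallP.
pose weight (B : {set 'I_m}) :=
  \sum_(g in retractions B) \prod_(i in B) w (fibre_size B g i).
have rhsE (B : {set 'I_m}) : #|B| = k -> 'C(m, k) * weight B = rhs k.
  by move=> <-; have := bin_mul_sum_retractions B w; rewrite card_ord.
transitivity (\sum_(B : {set 'I_m} | #|B| == k) weight B).
  apply: eq_bigr => B _; apply: eq_bigr => g gB.
  rewrite -card_components // -sum1dep_card; apply: eq_bigl => fs.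
  by move: gB; rewrite in_retractions /good => /andP[_ /eqP->].
have bin_gt0_mk : 0 < 'C(m, k) by rewrite bin_gt0 -ltnS; case/andP: k_range.
(* Each of the binom(m, k) sets [B] has weight [rhs k] divided by binom(m, k); multiplying both
   sides by this coefficient avoids the division. *)
apply/eqP; rewrite -(eqn_pmul2l bin_gt0_mk) big_distrr /=.
rewrite (eq_bigr (fun=> rhs k)) => [|B /eqP /rhsE //].
by rewrite sum_nat_const -cardsE card_draws card_ord.
Qed.
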